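(* Suppose $(X,E)$ is an expansive hyperbolic graph such that $\mathcal J_1(x)\neq\emptyset$ for all $x\in X$, and suppose $(X,E)$ has bounded degree, i.e. $\sup_{x\in X}\deg(x)<\infty$. Then the hyperbolic boundary $(\partial X,\theta_a)$ is a doubling metric space.
   Context: A rooted graph $(X,E)$ is a countable vertex set $X$ with a symmetric edge set $E\subset X\times X\setminus\Delta$ ($\Delta$ the diagonal) that is locally finite and connected, with a fixed root $\vartheta\in X$. Let $d$ be the graph distance on $(X,E)$, $|x|:=d(\vartheta,x)$, and $\deg(x)=\#\{y:(x,y)\in E\}$. For an integer $m\ge 0$, $\mathcal J_m(x)$ is the set of $y\in X$ with $|y|=|x|+m$ such that $x$ lies on some geodesic from $\vartheta$ to $y$. Let $E_h=\{(x,y)\in E:|x|=|y|\}$, and let $d_h$ be the graph distance on $(X,E_h)$ ($=\infty$ if no path exists). $(X,E)$ is expansive if for $x,y\in X$: $d_h(x,y)>1$ implies $d_h(u,v)>1$ for all $u\in\mathcal J_1(x)$, $v\in\mathcal J_1(y)$. The Gromov product is $(x|y)=\frac12(|x|+|y|-d(x,y))$, and $(X,E)$ is hyperbolic if there is $\delta\ge0$ with $(x|y)\ge\min\{(x|z),(z|y)\}-\delta$ for all $x,y,z\in X$. In this case, for a fixed $a>0$ with $e^{\delta a}<\sqrt2$, the Gromov metric on $X$ is $\theta_a(x,y)=\inf\{\sum_{i=1}^n e^{-a(x_{i-1}|x_i)}: n\ge1,\ x=x_0,x_1,\dots,x_n=y\in X\}$ for $x\ne y$, and $\theta_a(x,x)=0$.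 $\widehat X$ is the $\theta_a$-completion of $X$ (with the extended metric still denoted $\theta_a$), and $\partial X:=\widehat X\setminus X$ is the hyperbolic boundary. A metric space $(M,\rho)$ is doubling if there is an integer $\ell>0$ such that for any $\xi\in M$ and $r>0$ the ball $B_\rho(\xi,r)$ can be covered by at most $\ell$ balls of radius $r/2$. *)

(* Defs.v *)
From HB Require Import structures.
From mathcomp Require Import all_boot all_order all_algebra finmap.
From mathcomp Require Import all_classical all_reals all_analysis.

Set Implicit Arguments.
Unset Strict Implicit.
Unset Printing Implicit Defensive.

Import Order.TTheory GRing.Theory Num.Theory.

Local Open Scope classical_set_scope.
Local Open Scope ring_scope.

Section Graph.
Context {X : countType}.
Implicit Types (E : rel X) (x y z : X).

Definition neighbors E x : set X := [set y | E x y].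

(* The root plays no role in these axioms; it is a separate vertex below. *)
Definition is_graph E : Prop :=
  [/\ symmetric E, irreflexive E,
      forall x, finite_set (neighbors E x)
    & forall x y, exists2 p, path E x p & last x p = y].

(* Meaningful for locally finite E: fset_set of an infinite set is empty. *)
Definition deg E x : nat := #|` fset_set (neighbors E x)|.

Definition bounded_degree E : Prop := exists D : nat, forall x, (deg E x <= D)%N.

End Graph.

Section Distance.
Context (R : realType) {X : countType}.
Implicit Types (E : rel X) (x y : X).

(* The infimum of the empty set is +oo: the distance is infinite between
   vertices that no path connects. *)
Definition gdist E x y : \bar R :=
  ereal_inf [set (size p)%:R%:E | p in [set p | path E x p /\ last x p = y]].

End Distance.

Section RootedGraph.
Context (R : realType) {X : countType} (E : rel X) (root : X).
Implicit Types (x y z : X).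

(* Finite-valued because E is connected in all uses. *)
Definition dist x y : R := fine (gdist R E x y).

Definition level x : R := dist root x.

Definition geodesic x y (p : seq X) : Prop :=
  [/\ path E x p, last x p = y & (size p)%:R = dist x y].

(* The vertices visited by the path p issued from root are root :: p. *)
Definition descendants (m : nat) x : set X :=
  [set y | level y = level x + m%:R /\
           exists2 p, geodesic root y p & x \in root :: p].

Definition horizontal_edge : rel X := fun x y => E x y && (level x == level y).

Definition hdist x y : \bar R := gdist R horizontal_edge x y.

Definition expansive : Prop :=
  forall x y, (1 < hdist x y)%E ->
  forall u v, descendants 1 x u -> descendants 1 y v -> (1 < hdist u v)%E.

Definition gromov_product x y : R := (level x + level y - dist x y) / 2.

Definition hyperbolic_with (delta : R) : Prop :=
  0 <= delta /\
  forall x y z, gromov_product x y >=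
    Num.min (gromov_product x z) (gromov_product z y) - delta.

(* A chain x_0, ..., x_n is given by the first n + 1 values of u. *)
Definition chain_sums (a : R) x y : set R :=
  [set s | exists (n : nat) (u : nat -> X),
    [/\ (0 < n)%N, u 0%N = x, u n = y
      & s = \sum_(i < n) expR (- a * gromov_product (u i) (u i.+1))]].

Definition gromov_metric (a : R) x y : R :=
  if x == y then 0 else inf (chain_sums a x y).

End RootedGraph.

Section Completion.
Context {R : realType}.

(* M, with the embedding iota, is a completion of X for the distance rho. *)
Definition is_completion (X : Type) (rho : X -> X -> R)
    (M : metricType R) (iota : X -> M) : Prop :=
  [/\ forall x y, mdist (iota x) (iota y) = rho x y,
      dense (range iota)
    & forall F : set_system M, ProperFilter F -> cauchy F ->
        exists l : M, F --> l].

Definition boundary (X : Type) (M : metricType R) (iota : X -> M) : set M :=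
  ~` range iota.

End Completion.

(* The library gives a subset, seen as a type, its induced pseudometric
   structure; this adds the induced distance. *)
Section SubsetMetric.
Context {R : realType} {M : metricType R} (A : set M).

Let sub_mdist (x y : A) : R := mdist (set_val x) (set_val y).

Let sub_mdist_ge0 x y : 0 <= sub_mdist x y.
Proof. exact: mdist_ge0. Qed.

Let sub_mdist_positivity x y : sub_mdist x y = 0 -> x = y.
Proof. by move=> /mdist_positivity; exact: val_inj. Qed.

Let sub_ballEmdist x d : ball x d = [set y | sub_mdist x y < d].
Proof. by rewrite -initial_ballE ballEmdist. Qed.

HB.instance Definition _ := @PseudoMetric_isMetric.Build R (A : Type)
  sub_mdist sub_mdist_ge0 sub_mdist_positivity sub_ballEmdist.

End SubsetMetric.

Definition doubling {R : realType} (M : metricType R) : Prop :=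
  exists l : nat, (0 < l)%N /\
  forall (xi : M) (r : R), 0 < r ->
  exists2 s : seq M, (size s <= l)%N &
    ball xi r `<=` \bigcup_(z in [set` s]) ball z (r / 2).

(* Main.v *)
Require Import Defs.
From mathcomp Require Import all_boot all_order all_algebra finmap ring lra.
From mathcomp Require Import all_classical all_reals all_analysis.

Set Implicit Arguments.
Unset Strict Implicit.
Unset Printing Implicit Defensive.

Import Order.TTheory GRing.Theory Num.Theory.

Local Open Scope classical_set_scope.
Local Open Scope ring_scope.

(** The Gromov metric satisfies theta_a(x,y) <= exp(-a(x|y)) <= 2 theta_a(x,y)
for x <> y. Given a ball of radius r in the boundary, choose the level m with
exp(-am) of order r and attach to each boundary point a vertex of level m on a
geodesic from the root to a vertex very close to that point. Points with the
same vertex are less than r/2 apart, while by hyperbolicity the vertices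
attached to points of the ball lie within a distance L of each other that does
not depend on r; bounded degree leaves at most (D+1)^L of them. *)

(** * Graph distance: geodesics, metric axioms, size of balls *)

Section GraphDistance.
Context (R : realType) (X : countType) (E : rel X) (graphE : is_graph E).
Implicit Types x y z : X.

(** Connectedness makes the set of path lengths a nonempty set of naturals, so the infimum defining
    [gdist] is finite and attained. *)
Lemma geodesic_exists x y : exists p, geodesic R E x y p.
Proof.
have [_ _ _ connE] := graphE.
have [p0 Ep0 lp0] := connE x y.
pose P n := `[< exists p, [/\ path E x p, last x p = y & size p = n] >].
have exP : exists n, P n by exists (size p0); apply/asboolP; exists p0.
have [n /asboolP[p [Ep lp sp]] nmin] := ex_minnP exP.
exists p; split => //.
suff -> : dist R E x y = n%:R by rewrite sp.
suff : gdist R E x y = n%:R%:E by rewrite /dist => ->.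
apply/eqP; rewrite eq_le; apply/andP; split.
  by apply: ereal_inf_lbound; exists p => //=; rewrite sp.
apply: le_ereal_inf_tmp => _ [q [Eq lq] <-].
by rewrite lee_fin ler_nat; apply: nmin; apply/asboolP; exists q.
Qed.

Lemma dist_le_size x y p :
  path E x p -> last x p = y -> dist R E x y <= (size p)%:R.
Proof.
move=> Ep lp; have [q [_ _ sq]] := geodesic_exists x y.
have : (gdist R E x y <= (size p)%:R%:E)%E.
  by apply: ereal_inf_lbound; exists p.
have : (0 <= gdist R E x y)%E.
  by apply: le_ereal_inf_tmp => _ [r _ <-]; rewrite lee_fin.
by rewrite /dist; case: (gdist R E x y).
Qed.

Lemma dist_ge0 x y : 0 <= dist R E x y.
Proof. by have [p [_ _ <-]] := geodesic_exists x y. Qed.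

Lemma distxx x : dist R E x x = 0.
Proof.
by apply/eqP; rewrite eq_le dist_ge0 (@dist_le_size x x [::]).
Qed.

Lemma dist_triangle x y z : dist R E x z <= dist R E x y + dist R E y z.
Proof.
have [p [Ep lp <-]] := geodesic_exists x y.
have [q [Eq lq <-]] := geodesic_exists y z.
rewrite -natrD -size_cat; apply: dist_le_size.
  by rewrite cat_path Ep lp.
by rewrite last_cat lp.
Qed.

Lemma dist_sym x y : dist R E x y = dist R E y x.
Proof.
have symE : symmetric E by case: graphE.
suff le_dist u v : dist R E v u <= dist R E u v.
  by apply/eqP; rewrite eq_le !le_dist.
have [p [Ep lp <-]] := geodesic_exists u v.
rewrite -(size_belast u p) -(size_rev (belast u p)); apply: dist_le_size.
  rewrite -lp rev_path; apply: sub_path Ep => s t.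
  by rewrite /= symE.
by case: p lp {Ep} => [|s p] /= lp; rewrite ?lp // rev_cons last_rcons.
Qed.

(** Cut a geodesic after [m] steps: both pieces have at most the expected length, and the triangle
    inequality turns these bounds into equalities. *)
Lemma geodesic_point x y (m : nat) : m%:R <= dist R E x y ->
  exists2 z, dist R E x z = m%:R & dist R E z y = dist R E x y - m%:R.
Proof.
have [p [Ep lp sp]] := geodesic_exists x y.
rewrite -sp ler_nat => lemp.
exists (last x (take m p)).
  apply/eqP; rewrite eq_le; apply/andP; split.
    rewrite -[in X in _ <= X](size_takel lemp); apply: dist_le_size => //.
    by move: Ep; rewrite -{1}(cat_take_drop m p) cat_path => /andP[].
  have : dist R E (last x (take m p)) y <= (size (drop m p))%:R.
    apply: dist_le_size; last by rewrite -last_cat cat_take_drop.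
    by move: Ep; rewrite -{1}(cat_take_drop m p) cat_path => /andP[].
  have := dist_triangle x (last x (take m p)) y.
  by rewrite -sp size_drop natrB//; lra.
apply/eqP; rewrite eq_le; apply/andP; split.
  rewrite -natrB// -size_drop; apply: dist_le_size.
    by move: Ep; rewrite -{1}(cat_take_drop m p) cat_path => /andP[].
  by rewrite -last_cat cat_take_drop.
have : dist R E x (last x (take m p)) <= (size (take m p))%:R.
  apply: dist_le_size => //.
  by move: Ep; rewrite -{1}(cat_take_drop m p) cat_path => /andP[].
have := dist_triangle x (last x (take m p)) y.
by rewrite -sp size_takel//; lra.
Qed.

Lemma dist_ball_enum (D : nat) : (forall x, (deg E x <= D)%N) ->
  forall (L : nat) x, exists2 s : seq X, (size s <= D.+1 ^ L)%N &
    forall y, dist R E x y <= L%:R -> y \in s.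
Proof.
move=> degD; have [_ _ finE _] := graphE.
suff H (L : nat) x : exists2 s : seq X, (size s <= D.+1 ^ L)%N &
    forall p, path E x p -> (size p <= L)%N -> last x p \in s.
  move=> L x; have [s ss sP] := H L x; exists s => // y.
  by have [p [Ep <- <-]] := geodesic_exists x y; rewrite ler_nat; exact: sP.
elim: L x => [|L IH] x.
  by exists [:: x] => // -[|//] _ _; rewrite inE.
have [f fP] : {f : X -> seq X & forall z, (size (f z) <= D.+1 ^ L)%N /\
    forall p, path E z p -> (size p <= L)%N -> last z p \in f z}.
  apply: (choice (P := fun z s => (size s <= D.+1 ^ L)%N /\
    forall p, path E z p -> (size p <= L)%N -> last z p \in s)) => z.
  by have [s ? ?] := IH z; exists s.
(* Keeping [x] next to its neighbors covers the empty path, whence the factor [D.+1] instead of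
   [D]. *)
exists (flatten (map f (x :: enum_fset (fset_set (neighbors E x))))).
  have sum_le s : (size (flatten (map f s)) <= size s * D.+1 ^ L)%N.
    elim: s => //= z s IHs; rewrite size_cat mulSn leq_add//.
    by have [] := fP z.
  apply: leq_trans (sum_le _) _; rewrite expnS leq_mul2r /= ltnS.
  by apply/orP; right; exact: degD.
move=> p Ep sp; apply/flatten_mapP; case: p Ep sp => [|z p] /= Ep sp.
  by exists x; rewrite ?inE ?eqxx//; have [_ /(_ [::])] := fP x; apply.
move: Ep => /andP[Exz Ep]; exists z.
  by rewrite inE in_fset_set// mem_set ?orbT.
by have [_] := fP z; apply.
Qed.

End GraphDistance.

(** * Chains for a quasi-ultrametric with constant at most sqrt 2 *)

(* Split the chain at the step that crosses half of its total length. *)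
Lemma chain_bound (R : realType) (X : Type) (rho : X -> X -> R) (K : R) :
  (forall x y, 0 <= rho x y) -> 1 <= K -> K ^+ 2 <= 2 ->
  (forall x y z, rho x y <= K * Num.max (rho x z) (rho z y)) ->
  forall (u : nat -> X) (i j : nat), (i < j)%N ->
  rho (u i) (u j) <= 2 * \sum_(i <= l < j) rho (u l) (u l.+1).
Proof.
move=> rho0 K1 K2 rhoK u i j.
have [n] := ubnP (j - i)%N; elim: n i j => // n IH i j nij ij.
set S := \sum_(_ <= _ < _) _.
pose P k := [&& (i <= k)%N, (k < j)%N
  & 2 * \sum_(i <= l < k) rho (u l) (u l.+1) <= S].
have S0 : 0 <= S by exact: sumr_ge0.
have exP : exists k, P k by exists i; rewrite /P leqnn ij big_geq// mulr0.
have leP k : P k -> (k <= j)%N by move=> /and3P[_ /ltnW].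
(* [k] is the last index before [j] at which the head of the chain carries at most half of the total
   [S]. *)
have [k /and3P[ik kj kS] kmax] := ex_maxnP exP leP.
have splitS : S = \sum_(i <= l < k) rho (u l) (u l.+1) + rho (u k) (u k.+1)
    + \sum_(k.+1 <= l < j) rho (u l) (u l.+1).
  by rewrite /S (big_cat_nat (n := k.+1))//= ?big_nat_recr// ltnW.
have left0 : 0 <= \sum_(i <= l < k) rho (u l) (u l.+1) by exact: sumr_ge0.
have right0 : 0 <= \sum_(k.+1 <= l < j) rho (u l) (u l.+1) by exact: sumr_ge0.
have stepS : rho (u k) (u k.+1) <= S by lra.
have KS : S <= K * S by rewrite ler_peMl.
have KKS : K * (K * S) <= 2 * S by rewrite mulrA -expr2 ler_wpM2r.
have K0 : 0 <= K by lra.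
(* Joining the head and the crossing step costs one factor [K]; joining the tail costs a second, and
   K^2 <= 2 absorbs both. *)
have headS : rho (u i) (u k.+1) <= K * S.
  have [<-|neq_ik] := eqVneq k i; first exact: le_trans KS.
  have lt_ik : (i < k)%N by rewrite ltn_neqAle eq_sym neq_ik.
  apply: le_trans (rhoK _ _ (u k)) _; rewrite ler_wpM2l// ge_max stepS andbT.
  apply: le_trans (IH i k _ lt_ik) kS.
  by apply: leq_trans (_ : (j - i <= n)%N); rewrite ?ltn_sub2r.
have [jk|kj'] := leqP j k.+1.
  have <- : k.+1 = j by apply/eqP; rewrite eqn_leq kj jk.
  apply: le_trans headS _; apply: le_trans KKS.
  by rewrite ler_peMl// (le_trans S0).
(* By maximality of [k], the sum up to [k.+1] exceeds half of [S], so less than half remains. *)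
have tailS : 2 * \sum_(k.+1 <= l < j) rho (u l) (u l.+1) <= S.
  have : ~~ P k.+1 by apply/negP => /kmax; rewrite ltnn.
  rewrite /P kj' leqW//= big_nat_recr//= -ltNge; lra.
apply: le_trans (rhoK _ _ (u k.+1)) _.
apply: le_trans (_ : _ <= K * (K * S)) KKS; rewrite ler_wpM2l// ge_max headS /=.
apply: le_trans KS; apply: le_trans tailS; apply: IH => //.
by apply: leq_trans (_ : (j - i <= n)%N); rewrite ?ltn_sub2l ?ltnS.
Qed.

(** * Comparison of the Gromov metric with exp(-a(x|y)) *)

Section GromovMetric.
Context (R : realType) (X : countType) (E : rel X) (root : X) (delta a : R).
Context (graphE : is_graph E) (hypE : hyperbolic_with E root delta).
Context (a_gt0 : 0 < a) (a_small : expR (delta * a) < Num.sqrt 2).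
Implicit Types x y z : X.
Let gp x y := gromov_product R E root x y.
Let lev x := level R E root x.

Lemma gromov_productC x y :
  gromov_product R E root x y = gromov_product R E root y x.
Proof.
by rewrite /gromov_product (dist_sym R graphE x y) (addrC (level _ _ _ x)).
Qed.

Lemma gromov_productxx x : gromov_product R E root x x = level R E root x.
Proof. by rewrite /gromov_product distxx//; lra. Qed.

Lemma gromov_product_le x y : gromov_product R E root x y <= level R E root x.
Proof.
rewrite /gromov_product /level.
by have := dist_triangle R graphE root x y; lra.
Qed.

(** The hyperbolic inequality exponentiated: t -> exp(-at) is decreasing, so the minimum becomes a
    maximum and [delta] a factor. *)
Lemma exp_gromov_quasi_ultrametric x y z :
  expR (- a * gp x y) <=
  expR (delta * a) * Num.max (expR (- a * gp x z)) (expR (- a * gp z y)).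
Proof.
have [_ /(_ x y z)] := hypE; rewrite -/(gp x y) -/(gp x z) -/(gp z y).
move: (gp x y) (gp x z) (gp z y) => g g1 g2.
rewrite minElt maxElt ltr_expR ltr_nM2l ?oppr_lt0//.
case: ltgtP => [_|_|->] H; rewrite -expRD ler_expR;
  have := ler_wpM2l (ltW a_gt0) H; lra.
Qed.

Lemma expR_delta_sqr : expR (delta * a) ^+ 2 <= 2.
Proof.
rewrite -[leRHS](@sqr_sqrtr R 2)//.
by rewrite lerXn2r ?nnegrE ?expR_ge0 ?sqrtr_ge0// ltW.
Qed.

Lemma gromov_metric_le x y : x != y ->
  gromov_metric E root a x y <= expR (- a * gp x y).
Proof.
move=> xy; rewrite /gromov_metric (negbTE xy); apply: ge_inf.
  exists 0 => _ [n [u [_ _ _ ->]]]; apply: sumr_ge0 => i _; exact: expR_ge0.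
exists 1%N, (fun i => if i is 0%N then x else y); split => //.
by rewrite big_ord1.
Qed.

(** [chain_bound] with K = exp(delta a) bounds every chain sum below by half of exp(-a(x|y)), hence
    also their infimum. *)
Lemma le_gromov_metric x y : x != y ->
  expR (- a * gp x y) <= 2 * gromov_metric E root a x y.
Proof.
move=> xy; rewrite /gromov_metric (negbTE xy) -ler_pdivrMl//.
apply: lb_le_inf.
  eexists; exists 1%N, (fun i => if i is 0%N then x else y).
  by split.
move=> _ [n [u [n0 <- <- ->]]]; rewrite ler_pdivrMl//.
rewrite -(big_mkord xpredT (fun i => expR (- a * gp (u i) (u i.+1)))).
apply: (chain_bound (rho := fun x y => expR (- a * gp x y))
  (K := expR (delta * a))) => //.
- have [d0 _] := hypE; rewrite -expR0 ler_expR mulr_ge0 ?(ltW a_gt0)//.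
- exact: expR_delta_sqr.
- exact: exp_gromov_quasi_ultrametric.
Qed.

(** * Approximation of boundary points by vertices *)

Context (Xhat : metricType R) (iota : X -> Xhat).
Context (complX : is_completion (gromov_metric E root a) iota).

Lemma range_approx (xi : Xhat) (e : R) : 0 < e ->
  exists y, mdist xi (iota y) < e.
Proof.
move=> e0; have [_ denseX _] := complX.
have ball0 : (ball xi e)^° !=set0 by exists xi; exact: nbhsx_ballx.
have [z [xiz [y _ yz]]] := denseX _ ball0 (@open_interior _ _).
by exists y; move: xiz => /interior_subset; rewrite ballEmdist yz.
Qed.

(* The level of y is large because there is a second vertex z, strictly closer
   to xi: exp(-a|y|) <= exp(-a(y|z)) <= 2 theta_a(y,z). *)
Lemma boundary_approx (xi : Xhat) (e : R) (m : nat) :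
  boundary iota xi -> 0 < e ->
  exists2 y, mdist xi (iota y) < e & m%:R <= level R E root y.
Proof.
move=> bxi e0; have [isoX _ _] := complX.
(* With [y] and [z] both within exp(-am)/4 of [xi], twice their distance is below exp(-am). *)
have m0 : 0 < expR (- a * m%:R) / 4 by rewrite divr_gt0// expR_gt0.
have min0 : 0 < Num.min e (expR (- a * m%:R) / 4) by rewrite lt_min e0.
have [y] := range_approx xi min0; rewrite lt_min => /andP[xiy xiym].
exists y => //.
have xiy0 : 0 < mdist xi (iota y).
  by rewrite mdist_gt0; apply/eqP => xiE; apply: bxi; exists y.
have [z xiz] := range_approx xi xiy0.
have yz : y != z by apply: contraTneq xiz => ->; rewrite ltxx.
have := le_gromov_metric yz; rewrite -isoX.
have := metric_triangle (iota y) xi (iota z); rewrite (metric_sym _ xi) => ? ?.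
have := gromov_product_le y z => gle.
suff : expR (- a * level R E root y) < expR (- a * m%:R).
  by rewrite ltr_expR ltr_nM2l ?oppr_lt0// => /ltW.
have : expR (- a * level R E root y) <= expR (- a * gp y z).
  by rewrite ler_expR ler_nM2l ?oppr_lt0.
lra.
Qed.

(** * Vertices of level m attached to boundary points *)

(** The last two conditions say that [v] is the vertex of level [m] on some geodesic from the root
    to [y]; they give (v|y) = m. *)
Definition anchor (e : R) (m : nat) (xi : Xhat) (v : X) : Prop := exists y : X,
  [/\ mdist xi (iota y) < e, m%:R <= lev y, lev v = m%:R
    & dist R E v y = lev y - m%:R].

Lemma anchor_exists (e : R) (m : nat) (xi : Xhat) :
  boundary iota xi -> 0 < e -> exists v, anchor e m xi v.
Proof.
move=> bxi e0; have [y xiy my] := boundary_approx m bxi e0.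
have [v vm vy] := geodesic_point graphE my.
by exists v, y.
Qed.

(** Since (v|x) = (v|y) = m, hyperbolicity gives (x|y) >= m - delta. *)
Lemma anchored_close e m xi eta v : anchor e m xi v -> anchor e m eta v ->
  mdist xi eta < e *+ 2 + expR (delta * a - a * m%:R).
Proof.
move=> [x [xix mx vm vx]] [y [ety my _ vy]]; have [isoX _ _] := complX.
have xiet : mdist xi eta <=
    mdist xi (iota x) + mdist (iota x) (iota y) + mdist eta (iota y).
  rewrite (metric_sym eta).
  have := metric_triangle xi (iota x) eta.
  by have := metric_triangle (iota x) (iota y) eta; lra.
suff : mdist (iota x) (iota y) <= expR (delta * a - a * m%:R) by lra.
have [<-|xy] := eqVneq x y; first by rewrite mdistxx expR_ge0.
rewrite isoX (le_trans (gromov_metric_le xy))// ler_expR.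
have gvx : gp v x = m%:R.
  by rewrite /gp /gromov_product -/(lev v) -/(lev x) vm vx; lra.
have gvy : gp v y = m%:R.
  by rewrite /gp /gromov_product -/(lev v) -/(lev y) vm vy; lra.
have [_ /(_ x y v)] := hypE.
rewrite (gromov_productC x v) -/(gp v x) -/(gp v y) gvx gvy minxx => H.
by have := ler_wpM2l (ltW a_gt0) H; rewrite -/(gp x y); lra.
Qed.

(** The distance bound forces (x|y) >= m - c. Replacing [y] by [v] and then [x] by [u] costs [delta]
    each time, and d(u,v) = 2m - 2(u|v) on level [m]. *)
Lemma anchor_dist e m xi eta u v (c : R) : 0 <= c ->
  anchor e m xi u -> anchor e m eta v ->
  2 * (mdist xi eta + e *+ 2) <= expR (- a * (m%:R - c)) ->
  dist R E u v <= 2 * c + 4 * delta.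
Proof.
move=> c0 [x [xix mx um ux]] [y [ety my vm vy]] Hc; have [isoX _ _] := complX.
have xy : m%:R - c <= gp x y.
  have [<-|xy] := eqVneq x y.
    by rewrite /gp gromov_productxx// -/(lev x); lra.
  have := le_gromov_metric xy; rewrite -isoX.
  have := metric_triangle (iota x) xi (iota y).
  have := metric_triangle xi eta (iota y).
  rewrite (metric_sym _ xi) => ? ? ?.
  have : expR (- a * gp x y) <= expR (- a * (m%:R - c)) by lra.
  by rewrite ler_expR ler_nM2l ?oppr_lt0.
have gux : gp u x = m%:R.
  by rewrite /gp /gromov_product -/(lev u) -/(lev x) um ux; lra.
have gvy : gp v y = m%:R.
  by rewrite /gp /gromov_product -/(lev v) -/(lev y) vm vy; lra.
have [d0 hyp] := hypE.
have gxv : m%:R - c - delta <= gp x v.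
  apply: le_trans (hyp x v y).
  rewrite (gromov_productC y v) lerD2r le_min xy /=.
  by rewrite -/(gp v y) gvy; lra.
have guv : m%:R - c - delta *+ 2 <= gp u v.
  apply: le_trans (hyp u v x).
  rewrite mulr2n opprD addrA lerD2r le_min gxv andbT.
  by rewrite -/(gp u x) gux; lra.
by move: guv; rewrite /gp /gromov_product -/(lev u) -/(lev v) um vm; lra.
Qed.

(** Only the root has level 0. This serves large radii, where the least admissible level is 0 and
    its minimality yields no lower bound on exp(-am). *)
Lemma anchor0_dist e xi eta u v :
  anchor e 0 xi u -> anchor e 0 eta v -> dist R E u v = 0.
Proof.
move=> [x [_ _ um _]] [y [_ _ vm _]].
apply/eqP; rewrite eq_le dist_ge0// andbT.
have := dist_triangle R graphE u root v.
rewrite (dist_sym R graphE u root) -/(level R E root u) -/(level R E root v).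
by rewrite -/(lev u) -/(lev v) um vm addr0.
Qed.

(** * Covering a ball of the boundary *)

Lemma boundary_doubling : bounded_degree E ->
  doubling (set_type (boundary iota)).
Proof.
move=> [D degD]; have [d0 _] := hypE.
(* c makes exp(a (c - 1)) at least 16 exp(a delta). *)
pose c := 1 + (16 / a + delta).
have c0 : 0 <= c by rewrite /c !addr_ge0// divr_ge0// ltW.
have [L leL] : exists L : nat, 2 * c + 4 * delta <= L%:R.
  by eexists; apply: ltW; exact: truncnS_gt.
exists (D.+1 ^ L)%N; split; first by rewrite expn_gt0.
(* With e = r/16 and exp(delta a - am) <= r/4, points sharing a vertex are within r/8 + r/4 < r/2 of
   each other. *)
move=> xi r r0; pose e := r / 16.
have e0 : 0 < e by rewrite divr_gt0.
pose P (m : nat) := expR (delta * a - a * m%:R) <= r / 4.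
have exP : exists m, P m.
  exists (Num.truncn ((delta * a - ln (r / 4)) / a)).+1.
  rewrite /P -[leRHS]lnK ?posrE ?divr_gt0// ler_expR.
  set M := (Num.truncn _).+1.
  have : (delta * a - ln (r / 4)) / a < M%:R by exact: truncnS_gt.
  by rewrite ltr_pdivrMr//; lra.
have [m mr mmin] := ex_minnP exP.
have [u xiu] := anchor_exists m (set_valP xi) e0.
have [s ss sP] := dist_ball_enum R graphE degD L u.
(* The new centers must lie in the boundary: [f] picks for each vertex a boundary point anchored at
   it, and [xi] by default if there is none. *)
have [f fP] : {f : X -> set_type (boundary iota) & forall v,
    (exists eta, boundary iota eta /\ anchor e m eta v) ->
    anchor e m (set_val (f v)) v}.
  apply: (choice (P := fun v (z : set_type (boundary iota)) =>
    (exists eta, boundary iota eta /\ anchor e m eta v) ->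
    anchor e m (set_val z) v)) => v.
  have [[eta [beta etav]]|] :=
      pselect (exists eta, boundary iota eta /\ anchor e m eta v).
    by exists (exist _ eta (mem_set beta)).
  by exists xi.
exists (map f s); first by rewrite size_map.
move=> eta; rewrite ballEmdist /= => xieta.
have {}xieta : mdist (set_val xi) (set_val eta) < r by [].
have [v etav] := anchor_exists m (set_valP eta) e0.
have uv : dist R E u v <= L%:R.
  case: m mr mmin xiu etav {fP sP} => [|m] mr mmin xiu etav.
    by rewrite (anchor0_dist xiu etav).
  apply: le_trans leL; apply: (anchor_dist c0 xiu etav).
  have : ~~ P m by apply/negP => /mmin; rewrite ltnn.
  rewrite /P -ltNge => rm.
  apply: (@le_trans _ _ (16 * (r / 4))); first by rewrite /e; lra.
  (* The level is now [m.+1], and minimality gives r/4 < exp(delta a - am). The factor 16 is bounded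
     by exp(16), which the term 16/a of [c] supplies. *)
  apply: (@le_trans _ _ (expR 16 * expR (delta * a - a * m%:R))).
    rewrite ler_pM ?(ltW rm) ?divr_ge0 ?(ltW r0)//.
    by apply: le_trans (expR_ge1Dx _); lra.
  rewrite -expRD ler_expR /c -[m.+1]addn1 natrD.
  have -> : - a * (m%:R + 1%:R - (1 + (16 / a + delta))) =
     a / a * 16 + delta * a - a * m%:R by ring.
  by rewrite divff ?gt_eqF//; lra.
exists (f v) => /=; first by apply: map_f; exact: sP.
rewrite ballEmdist /=.
have := anchored_close (fP v (ex_intro _ _ (conj (set_valP eta) etav))) etav.
have <- : mdist (f v) eta = mdist (set_val (f v)) (set_val eta) by [].
move: mr; rewrite /P /e; lra.
Qed.

End GromovMetric.

Theorem theorem1p2 (R : realType) (X : countType) (E : rel X) (root : X)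
    (delta a : R) (Xhat : metricType R) (iota : X -> Xhat)
    (graphE : is_graph E)
    (expansiveE : expansive R E root)
    (hyperbolicE : hyperbolic_with E root delta)
    (J1_nonempty : forall x : X, descendants R E root 1 x !=set0)
    (boundedE : bounded_degree E)
    (a_gt0 : 0 < a)
    (a_small : expR (delta * a) < Num.sqrt 2)
    (Xhat_completion : is_completion (gromov_metric E root a) iota) :
  doubling (set_type (boundary iota)).
Proof.
exact: (boundary_doubling graphE hyperbolicE a_gt0 a_small Xhat_completion).
Qed.
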